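(* Fix an equation $(f,q,w)$ as in the context. Let $K=(k_{ij})\in SL(2,\mathbb R)$, $\gamma\in(-\pi,\pi]$, and write $\lambda_n(e^{i\gamma}K)$ for the eigenvalues with the boundary condition $[e^{i\gamma}K\,|\,-I]$. Let $\mathbf T_K=\begin{pmatrix}0&1&0&0\\0&0&-k_{21}&k_{11}\end{pmatrix}$ and $\mathbf U_K=\begin{pmatrix}k_{11}&k_{12}&0&0\\0&0&1&0\end{pmatrix}$. Then the problem with $[e^{i\gamma}K|-I]$ has exactly $N$ eigenvalues if $k_{11}-f_0k_{12}\ne0$ and $N-1$ if $k_{11}-f_0k_{12}=0$; with $\mathbf T_K$ exactly $N$ if $k_{11}\neq0$ and $N-1$ if $k_{11}=0$; with $\mathbf U_K$ exactly $N-1$ if $k_{11}-f_0k_{12}\neq0$ and $N-2$ if $k_{11}-f_0k_{12}=0$. Furthermore: (i) if $(k_{11}-f_0k_{12})k_{11}f_0>0$: $\lambda_n(\mathbf T_K)\le\lambda_n(e^{i\gamma}K)$ for $0\le n\le N-1$ and $\lambda_n(e^{i\gamma}K)\le\lambda_{n+1}(\mathbf T_K)$ for $0\le n\le N-2$; if $(k_{11}-f_0k_{12})k_{11}f_0<0$: $\lambda_n(e^{i\gamma}K)\le\lambda_n(\mathbf T_K)$ for $0\le n\le N-1$ and $\lambda_n(\mathbf T_K)\le\lambda_{n+1}(e^{i\gamma}K)$ for $0\le n\le N-2$; if $k_{11}-f_0k_{12}=0$: $\lambda_n(\mathbf T_K)\le\lambda_n(e^{i\gamma}K)\le\lambda_{n+1}(\mathbf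 T_K)$ for $0\le n\le N-2$; if $k_{11}=0$: $\lambda_n(e^{i\gamma}K)\le\lambda_n(\mathbf T_K)\le\lambda_{n+1}(e^{i\gamma}K)$ for $0\le n\le N-2$; (ii) if $k_{11}-f_0k_{12}\neq0$: $\lambda_n(e^{i\gamma}K)\le\lambda_n(\mathbf U_K)\le\lambda_{n+1}(e^{i\gamma}K)$ for $0\le n\le N-2$; if $k_{11}-f_0k_{12}=0$: $\lambda_n(e^{i\gamma}K)\le\lambda_n(\mathbf U_K)\le\lambda_{n+1}(e^{i\gamma}K)$ for $0\le n\le N-3$.
   Context: Let $N\ge2$ be an integer. An equation is given by real sequences $f=\{f_n\}_{n=0}^N$, $q=\{q_n\}_{n=1}^N$, $w=\{w_n\}_{n=1}^N$ with $f_n\neq0$, $w_n>0$; it is $-\nabla(f_n\Delta y_n)+q_ny_n=\lambda w_ny_n$, $1\le n\le N$, for $y=\{y_n\}_{n=0}^{N+1}$, $\Delta y_n=y_{n+1}-y_n$, $\nabla y_n=y_n-y_{n-1}$. A boundary condition $[A\,|\,B]$ (equivalently the $2\times4$ coefficient matrix $(A,B)$ of rank 2) is $A(y_0,f_0\Delta y_0)^T+B(y_N,f_N\Delta y_N)^T=0$; matrices differing by left multiplication by an invertible $2\times2$ complex matrix give the same condition. $SL(2,\mathbb R)$ is the set of real $2\times2$ matrices of determinant 1; $I$ is the identity. Eigenvalues ($\lambda$ with a nontrivial solution) of these self-adjoint problems are real; multiplicity = dimension of the solution space (equal to the multiplicity as a zero of the characteristic polynomial); counted with multiplicity they are ordered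 $\lambda_0\le\lambda_1\le\cdots$, and ''exactly $k$ eigenvalues'' counts multiplicity. *)

(* Defs.v *)
From HB Require Import structures.
From mathcomp Require Import all_boot all_order all_algebra.
From mathcomp Require Import complex.
From mathcomp Require Import reals trigo.
Set Implicit Arguments. Unset Strict Implicit. Unset Printing Implicit Defensive.
Import Order.TTheory GRing.Theory Num.Theory.
Local Open Scope ring_scope.

Section SturmLiouville.
Variable R : realType.
Local Notation C := (R[i]).

Definition rC (x : R) : C := Complex x 0.

Definition expi (g : R) : C := Complex (cos g) (sin g).

Definition mx2x4 (r0 r1 : seq C) : 'M[C]_(2,4) :=
  \matrix_(i < 2, j < 4) nth 0 (if (i : nat) == 0%N then r0 else r1) j.

(* A sequence y = (y_0, ..., y_{N+1}) is represented by y : 'rV[C]_(N+2);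
   y_n is ysq y n. *)
Definition ysq (N : nat) (y : 'rV[C]_N.+2) (n : nat) : C := y 0 (inord n).

(* Residual of the problem at lambda: component n (1 <= n <= N) is
   -nabla(f_n Delta y_n) + q_n y_n - lambda w_n y_n; components 0 and N+1
   are the two rows of  M (y_0, f_0 Delta y_0, y_N, f_N Delta y_N)^T,
   where M = (A, B) is the 2x4 coefficient matrix of the boundary condition. *)
Definition sl_res (N : nat) (f q w : nat -> R) (M : 'M[C]_(2,4)) (lam : C)
  (y : 'rV[C]_N.+2) : 'rV[C]_N.+2 :=
  let Y := ysq y in
  let F n := rC (f n) in
  let bcv : 'cV[C]_4 :=
    \col_(j < 4) nth 0 [:: Y 0%N; F 0%N * (Y 1%N - Y 0%N);
                          Y N; F N * (Y N.+1 - Y N)] j in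
  let bc := M *m bcv in
  \row_(j < N.+2)
    if (j : nat) == 0%N then bc 0 0
    else if (j : nat) == N.+1 then bc 1 0
    else - (F j * (Y j.+1 - Y j) - F j.-1 * (Y j - Y j.-1))
         + rC (q j) * Y j - lam * rC (w j) * Y j.

Arguments sl_res : clear implicits.

Definition sl_mult (N : nat) (f q w : nat -> R) (M : 'M[C]_(2,4)) (lam : C)
  : nat := \rank (kermx (lin1_mx (sl_res N f q w M lam))).

(* s is the list of all eigenvalues (all real), repeated according to
   multiplicity and sorted nondecreasingly: s = [:: lambda_0; lambda_1; ...] *)
Definition eig_list (N : nat) (f q w : nat -> R) (M : 'M[C]_(2,4))
  (s : seq R) : Prop :=
  sorted (fun x y : R => x <= y) s /\
  forall lam : C, sl_mult N f q w M lam = count (fun x => rC x == lam) s.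

End SturmLiouville.

Definition bc_EK (R : realType) (K : 'M[R]_2) (g : R) : 'M[R[i]]_(2,4) :=
  mx2x4 [:: expi g * rC (K 0 0); expi g * rC (K 0 1); -1; 0]
        [:: expi g * rC (K 1 0); expi g * rC (K 1 1); 0; -1].
Definition bc_T (R : realType) (K : 'M[R]_2) : 'M[R[i]]_(2,4) :=
  mx2x4 [:: 0; 1; 0; 0] [:: 0; 0; rC (- K 1 0); rC (K 0 0)].
Definition bc_U (R : realType) (K : 'M[R]_2) : 'M[R[i]]_(2,4) :=
  mx2x4 [:: rC (K 0 0); rC (K 0 1); 0; 0] [:: 0; 0; 1; 0].

(* Main.v *)
Require Import Defs.
From HB Require Import structures.
From mathcomp Require Import all_boot all_order all_algebra all_fingroup.
From mathcomp Require Import complex.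
From mathcomp Require Import reals trigo.
From mathcomp Require Import zify ring lra.
Set Implicit Arguments. Unset Strict Implicit. Unset Printing Implicit Defensive.
Import Order.TTheory GRing.Theory Num.Theory.
Local Open Scope ring_scope.
Local Open Scope sesquilinear_scope.

(** Written in the interior unknowns [y_1, ..., y_N], each of the three problems
    is the eigenvalue problem of a Hermitian form [Q] on a subspace [V] of [C^N],
    relative to [diag w]: summation by parts leaves only the boundary term
    [conj y_1 * f_0 Delta y_0 - conj y_N * f_N Delta y_N], and a self-adjoint
    boundary condition says that [(y_1, y_N)] lies in a subspace of [C^2] on
    which that term is a Hermitian form [beta].  Put [c = k11 - f_0 k12].
    - If [c != 0], then [e^(i gamma) K] imposes no constraint and [U_K] is its
      restriction to [y_N = 0]; if [k11 = 0], then so is [T_K].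
    - If [k11 != 0], then [T_K] imposes no constraint; if moreover [c = 0], then
      [e^(i gamma) K] is its restriction to [y_N = e^(i gamma) k11 y_1], and
      [U_K] is its restriction to [y_1 = y_N = 0].
    - If [c != 0] and [k11 != 0], the forms of [e^(i gamma) K] and [T_K] differ by
      the rank one form [f_0 / (c k11) * |k11 y_1 - e^(- i gamma) y_N|^2].
    All the inequalities are then Courant-Fischer interlacing. *)

(** * Sorted eigenbases of Hermitian forms on a subspace, and their interlacing *)

Section HermitianForms.
Variable R : rcfType.
Local Notation C := R[i].

Lemma trmxC_mul m n p (A : 'M[C]_(m, n)) (B : 'M_(n, p)) :
  (A *m B)^t* = B^t* *m A^t*.
Proof. by rewrite trmx_mul map_mxM. Qed.

Lemma mulmx_congr m n p (A : 'M[C]_(m, n)) (B : 'M_(n, p)) (M : 'M_p) :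
  A *m B *m M *m (A *m B)^t* = A *m (B *m M *m B^t*) *m A^t*.
Proof. by rewrite trmxC_mul !mulmxA. Qed.

Lemma quad_diag m (d b : 'rV[C]_m) :
  (b *m diag_mx d *m b^t*) 0 0 = \sum_i d 0 i * `|b 0 i| ^+ 2.
Proof.
rewrite mxE; apply: eq_bigr => i _; rewrite mul_mx_diag !mxE normCK.
by rewrite mulrAC mulrA mulrC mulrA.
Qed.

Lemma rank_diag_mx (F : fieldType) m (d : 'rV[F]_m) :
  \rank (diag_mx d) = #|[pred i | d 0 i != 0]|.
Proof.
transitivity (\rank (\sum_(i | d 0 i != 0) <<delta_mx 0 i : 'rV[F]_m>>)%MS).
  apply/eqmx_rank/andP; split.
    apply/row_subP => i; rewrite row_diag_mx.
    have [->|di0] := eqVneq (d 0 i) 0; first by rewrite scale0r sub0mx.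
    by rewrite scalemx_sub // (sumsmx_sup i) // genmxE.
  apply/sumsmx_subP => i di0; rewrite genmxE.
  rewrite -[delta_mx 0 i](scalerK di0) -row_diag_mx scalemx_sub //.
  exact: row_sub.
have /mxdirectP -> /= : mxdirect (\sum_(i | d 0 i != 0) <<delta_mx 0 i : 'rV[F]_m>>).
  by apply: mxdirect_delta => i j _ _.
rewrite -sum1_card; apply: eq_bigr => i _.
by rewrite mxrank_gen mxrank_delta.
Qed.

(* The rows of [E] are eigenvectors, orthonormal for [W], of the compression
   of the form [Q] to the row space of [V]. *)
Definition eigenbasis N m d (W Q : 'M[C]_N) (V : 'M[C]_(d, N)) (s : seq R)
    (E : 'M[C]_(m, N)) : Prop :=
  [/\ size s = m, sorted <=%R s, (E :=: V)%MS, E *m W *m E^t* = 1%:M &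
      E *m Q *m E^t* = diag_mx (\row_i (s`_i)%:C%C)].

Lemma eigenbasis_free N m d (W Q : 'M[C]_N) (V : 'M_(d, N)) s (E : 'M_(m, N)) :
  eigenbasis W Q V s E -> row_free E.
Proof.
case=> _ _ _ EWE _; apply/row_freeP; exists (W *m E^t*).
by rewrite mulmxA.
Qed.

(** Rescaling by the square root of [w] turns [w]-orthonormality into ordinary orthonormality, so
    Gram-Schmidt yields a [w]-orthonormal basis [F] of [V]. The spectral theorem diagonalizes [Q] in
    that basis, and a permutation sorts the eigenvalues. *)
Lemma eigenbasis_exists N d (w : 'rV[C]_N) (Q : 'M[C]_N) (V : 'M_(d, N)) :
  (forall i, 0 < w 0 i) -> Q^t* = Q ->
  exists s (E : 'M_(\rank V, N)), eigenbasis (diag_mx w) Q V s E.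
Proof.
move=> w0 Qh.
pose r := map_mx sqrtC w.
pose ri := map_mx (fun x => (sqrtC x)^-1) w.
have r0 i : 0 < r 0 i by rewrite mxE sqrtC_gt0.
have diagC (x : 'rV[C]_N) : (forall i, 0 < x 0 i) -> (diag_mx x)^t* = diag_mx x :> 'M[C]_N.
  move=> x0; rewrite tr_diag_mx map_diag_mx; congr diag_mx; apply/rowP => i.
  by rewrite mxE; apply/CrealP/ger0_real/ltW.
have rri : diag_mx r *m diag_mx ri = 1%:M.
  apply/matrixP => i j; rewrite mul_diag_mx !mxE.
  case: eqP => [->|_]; last by rewrite !mulr0n mulr0.
  by rewrite !mulr1n divff // sqrtC_eq0 gt_eqF.
have rir : diag_mx ri *m diag_mx r = 1%:M by rewrite diag_mxC.
have rr : diag_mx ri *m diag_mx w *m diag_mx ri = 1%:M.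
  rewrite (_ : diag_mx w = diag_mx r *m diag_mx r); last first.
    apply/matrixP => i j; rewrite mul_diag_mx !mxE.
    by case: eqP => [->|_]; rewrite ?mulr0n ?mulr0 // !mulr1n -expr2 sqrtCK.
  by rewrite mulmxA rir mul1mx.
pose V' := row_base V *m diag_mx r.
pose P := schmidt V'.
have freeV' : row_free V'.
  rewrite /row_free mxrankMfree ?(eqP (row_base_free V)) //.
  by apply/row_freeP; exists (diag_mx ri).
have PV' : (P :=: V')%MS by apply: eqmx_schmidt_free.
have PP : P *m P^t* = 1%:M.
  apply/unitarymxP/schmidt_unitarymx.
  by rewrite rank_leq_col.
pose F := P *m diag_mx ri.
have riC : (diag_mx ri)^t* = diag_mx ri.
  by apply: diagC => i; rewrite mxE invr_gt0 sqrtC_gt0.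
have FWF : F *m diag_mx w *m F^t* = 1%:M.
  by rewrite /F mulmx_congr riC rr mulmx1.
have FV : (F :=: V)%MS.
  apply: eqmx_trans (eq_row_base V); apply: eqmx_trans (eqmxMr _ PV') _.
  by rewrite /V' -mulmxA rri mulmx1; apply: eqmx_refl.
pose H := F *m Q *m F^t*.
have HH : H \is hermsymmx.
  apply/is_hermitianmxP; rewrite expr0 scale1r /H (trmxC_mul (F *m Q)) (trmxC_mul F) trmxCK Qh.
  by rewrite mulmxA.
have HS := orthomx_spectralP (hermitian_normalmx HH).
have Hr := hermitian_spectral_diag_real HH.
have U1 := spectral_unitarymx H; have U2 := spectral_unit H.
move: HS Hr U1 U2; set U := spectralmx H; set D := spectral_diag H => HS Hr U1 U2.
pose G := U *m F.
have UU : U *m U^t* = 1%:M by apply/unitarymxP.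
have GV : (G :=: V)%MS.
  by apply: eqmx_trans FV; apply: eqmxMfull; rewrite row_full_unit.
have GWG : G *m diag_mx w *m G^t* = 1%:M.
  by rewrite mulmx_congr FWF mulmx1.
have GQG : G *m Q *m G^t* = diag_mx D.
  rewrite mulmx_congr -/H {1}HS !mulmxA mulmxV // mul1mx -mulmxA.
  by rewrite UU mulmx1.
pose t : seq R := [seq complex.Re (D 0 i) | i <- enum 'I_(\rank V)].
have st : size t == \rank V by rewrite size_map size_enum_ord.
have ss : perm_eq (sort <=%R t) (Tuple st) by rewrite perm_sort.
have /tuple_permP[p Hp] := ss.
exists (sort <=%R t), (row_perm p G); split.
- by rewrite size_sort (eqP st).
- exact: sort_le_sorted.
- apply: eqmx_trans GV; rewrite row_permE; apply: eqmxMfull.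
  by rewrite row_full_unit unitmx_perm.
- rewrite row_permE mulmx_congr GWG mulmx1 tr_perm_mx map_perm_mx -perm_mxM.
  by rewrite mulgV perm_mx1.
- rewrite Hp /= row_permE mulmx_congr GQG tr_perm_mx map_perm_mx.
  rewrite -row_permE; apply/matrixP => i j.
  rewrite -col_permE !mxE (nth_map i) ?size_enum_ord // nth_ord_enum.
  rewrite (tnth_nth 0) /= (nth_map i) ?size_enum_ord // nth_ord_enum.
  rewrite (inj_eq perm_inj); case: eqP => [->|//].
  rewrite RRe_real //; exact: (mxOverP Hr).
Qed.

Lemma eigenbasis_quad N m d (W Q : 'M[C]_N) (V : 'M_(d, N)) s (E : 'M_(m, N))
    (b : 'rV_m) : eigenbasis W Q V s E ->
  (b *m E *m W *m (b *m E)^t*) 0 0 = \sum_i `|b 0 i| ^+ 2 /\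
  (b *m E *m Q *m (b *m E)^t*) 0 0 = \sum_(i < m) (s`_i)%:C%C * `|b 0 i| ^+ 2.
Proof.
case=> _ _ _ EWE EQE; split; rewrite mulmx_congr.
  rewrite EWE -diag_const_mx quad_diag.
  by apply: eq_bigr => i _; rewrite mxE mul1r.
rewrite EQE quad_diag.
by apply: eq_bigr => i _; rewrite mxE.
Qed.

(* Courant-Fischer by counting dimensions: a nonzero vector common to [X], the
   span of the first [j.+1] eigenvectors of [Q2] and the span of the
   eigenvectors of [Q1] from the [n]-th on has both Rayleigh quotients. *)
Lemma eigenbasis_le N m1 m2 d1 d2 k (W Q1 Q2 : 'M[C]_N)
    (V1 : 'M_(d1, N)) (V2 : 'M_(d2, N)) (X : 'M_(k, N)) s1 s2
    (E1 : 'M_(m1, N)) (E2 : 'M_(m2, N)) (n j : nat) :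
  eigenbasis W Q1 V1 s1 E1 -> eigenbasis W Q2 V2 s2 E2 ->
  (X <= V1)%MS -> (X <= V2)%MS ->
  (forall v : 'rV_N, (v <= X)%MS ->
     (v *m Q1 *m v^t*) 0 0 <= (v *m Q2 *m v^t*) 0 0) ->
  (n < m1)%N -> (j < m2)%N -> (n + \rank V2 <= j + \rank X)%N ->
  s1`_n <= s2`_j.
Proof.
move=> B1 B2 X1 X2 leQ nm1 jm2 dims.
have fE1 := eigenbasis_free B1; have fE2 := eigenbasis_free B2.
have [z1 o1 eV1 _ _] := B1; have [z2 o2 eV2 _ _] := B2.
pose hi := copid_mx n *m E1; pose lo := (pid_mx j.+1 : 'M_m2) *m E2.
have rhi : \rank hi = (m1 - n)%N by rewrite mxrankMfree // rank_copid_mx // ltnW.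
have rlo : \rank lo = j.+1 by rewrite mxrankMfree // rank_pid_mx.
have hiV : (hi <= V1)%MS by rewrite -eV1 submxMl.
have loV : (lo <= V2)%MS by rewrite -eV2 submxMl.
have rV1 : \rank V1 = m1 by rewrite -eV1; exact/eqP.
(* Inside [V2], [X] and [lo] meet in dimension at least [n + 1], which exceeds the codimension [n]
   of [hi] in [V1]. *)
have c1 : (n < \rank (X :&: lo)%MS)%N.
  have := mxrank_sum_cap X lo; have : (\rank (X + lo)%MS <= \rank V2)%N.
    by rewrite mxrankS // addsmx_sub X2.
  by rewrite rlo; lia.
have c2 : ((X :&: lo) :&: hi)%MS != 0.
  rewrite -mxrank_eq0.
  have := mxrank_sum_cap (X :&: lo)%MS hi.
  have : (\rank (X :&: lo + hi)%MS <= \rank V1)%N.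
    by rewrite mxrankS // addsmx_sub hiV andbT (submx_trans (capmxSl _ _)).
  by rewrite rhi rV1; lia.
have /rowV0Pn[v] := c2.
rewrite !sub_capmx -andbA => /and3P[vX /submxP[b vb] /submxP[a va]] v0.
have {}vb : v = b *m (pid_mx j.+1 : 'M_m2) *m E2 by rewrite vb mulmxA.
have {}va : v = a *m copid_mx n *m E1 by rewrite va mulmxA.
have := leQ v vX.
have [] := eigenbasis_quad (b *m (pid_mx j.+1 : 'M_m2)) B2; rewrite -vb => W2 ->.
have [] := eigenbasis_quad (a *m copid_mx n) B1; rewrite -va W2 => W1 ->.
set b' := b *m _ in vb W1 *; set a' := a *m _ in va W1 *.
(* The coordinates [b'] of [v] live on indices up to [j], and [a'] on indices from [n] on; by [W1]
   both have the same sum of squares. *)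
have b'0 (i : 'I_m2) : (j < i)%N -> b' 0 i = 0.
  move=> ji; rewrite mxE big1 // => l _; rewrite mxE.
  case: eqP => [->|_]; last by rewrite mulr0.
  by rewrite ltnS leqNgt ji mulr0.
have a'0 (i : 'I_m1) : (i < n)%N -> a' 0 i = 0.
  move=> ni; rewrite mxE big1 // => l _; rewrite !mxE -val_eqE /=.
  by case: eqP => [->|_]; rewrite ?ni /= ?subrr ?subr0 ?mulr0.
have b'nz : 0 < \sum_i `|b' 0 i| ^+ 2.
  have : b' != 0 by apply: contraNneq v0 => b0; rewrite vb b0 mul0mx.
  case/rV0Pn => i bi; rewrite (bigD1 i) //= ltr_pwDl //.
    by rewrite exprn_gt0 // normr_gt0.
  by apply: sumr_ge0 => l _; rewrite exprn_ge0.
have le_nth (s : seq R) i l : sorted <=%R s -> (i <= l)%N -> (l < size s)%N ->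
    s`_i <= s`_l.
  by move=> so il ls; apply: (sorted_leq_nth le_trans lexx) => //; rewrite inE //; apply: leq_ltn_trans ls.
move=> le12; rewrite -lecR -(ler_pM2r b'nz).
rewrite [X in X <= _](_ : _ = \sum_i (s1`_n)%:C%C * `|a' 0 i| ^+ 2); last first.
  by rewrite W1 mulr_sumr.
rewrite mulr_sumr.
apply: le_trans (le_trans le12 _).
  apply: ler_sum => i _; have [ni|ni] := ltnP i n.
    by rewrite a'0 // normr0 expr0n !mulr0.
  by rewrite ler_wpM2r ?exprn_ge0 // lecR le_nth // z1.
apply: ler_sum => i _; have [ji|ji] := ltnP j i.
  by rewrite b'0 // normr0 expr0n !mulr0.
by rewrite ler_wpM2r ?exprn_ge0 // lecR le_nth // z2.
Qed.

(** In the coordinates of [E], the kernel of the compression of [Q - lam W] to [V] is that of the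
    diagonal matrix with entries [s_i - lam], whose dimension is the number of zero entries. *)
Lemma eigenbasis_mult N m d (W Q : 'M[C]_N) (V : 'M_(d, N)) s (E : 'M_(m, N))
    (lam : C) : eigenbasis W Q V s E ->
  \rank (V :&: kermx ((Q - lam *: W) *m V^t*))%MS =
  count (fun x => x%:C%C == lam) s.
Proof.
move=> B; have fE := eigenbasis_free B; have [zs _ eV EWE EQE] := B.
pose D := diag_mx (\row_(i < m) ((s`_i)%:C%C - lam)).
have EE : E *m (Q - lam *: W) *m E^t* = D.
  rewrite mulmxBr mulmxBl EQE -scalemxAr -scalemxAl EWE.
  apply/matrixP => i j; rewrite !mxE.
  by case: (i == j); rewrite ?mulr1n ?mulr0n ?mulr1 ?mulr0 ?subr0.
have [Z ZE] : exists Z, V = Z *m E by apply/submxP; rewrite eV.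
have [Y YE] : exists Y, E = Y *m V by apply/submxP; rewrite -eV.
have -> : \rank (V :&: kermx ((Q - lam *: W) *m V^t*))%MS = \rank (kermx D *m E).
  apply/eqmx_rank/andP; split; apply/rV_subP => v.
    rewrite sub_capmx -eV => /andP[/submxP[a ->] /sub_kermxP av].
    apply: submxMr; apply/sub_kermxP; rewrite -EE [in E^t*]YE trmxC_mul.
    by rewrite !mulmxA in av *; rewrite av mul0mx.
  case/submxP => a ->; rewrite mulmxA sub_capmx -{1}eV submxMl /=.
  apply/sub_kermxP; transitivity
    (a *m (kermx D *m (E *m (Q - lam *: W) *m E^t*)) *m Z^t*).
    by rewrite [in V^t*]ZE trmxC_mul !mulmxA.
  by rewrite EE mulmx_ker mulmx0 mul0mx.
rewrite mxrankMfree // mxrank_ker rank_diag_mx.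
set A := [pred i | _]; rewrite -[m in (m - _)%N]card_ord -(cardC A) addKn.
rewrite -sum1_count (big_nth 0) zs big_mkord -sum1_card.
by apply: eq_bigl => i; rewrite !inE mxE negbK subr_eq0.
Qed.
End HermitianForms.

HB.instance Definition _ (R : realType) :=
  GRing.RMorphism.copy (@rC R) (real_complex R).

Lemma mul_trmxC_eq0 (R : realType) m k (t : 'rV[R[i]]_m) (Z : 'M_(k, m)) :
  (forall j, t *m (row j Z)^t* = 0) -> t *m Z^t* = 0.
Proof.
move=> tZ; apply/rowP => j; rewrite [RHS]mxE.
have /matrixP/(_ 0 0) := tZ j; rewrite [X in _ = X -> _]mxE => <-.
by rewrite !mxE; apply: eq_bigr => i _; rewrite !mxE.
Qed.

(** * Reduction of the difference problem to a form in the interior unknowns *)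

Section Reduction.
Variable R : realType.
Local Notation C := R[i].
Variables (n : nat) (f q w : nat -> R).
Local Notation N := n.+2.
Local Notation slres := (@sl_res R N f q w).

Definition row2 (a b : C) : 'rV[C]_2 := \row_j if j == 0 then a else b.

Lemma row2_eq (a b c d : C) : row2 a b = row2 c d <-> a = c /\ b = d.
Proof.
split=> [/rowP h|[-> ->//]]; have := h 0; have := h 1.
by rewrite !mxE /=.
Qed.

Lemma row2E (z : 'rV[C]_2) : z = row2 (z 0 0) (z 0 1).
Proof.
apply/rowP => j; rewrite mxE; case: (unliftP 0 j) => [k|] -> //=.
by rewrite !ord1; congr (z 0 _); apply/val_inj.
Qed.

Lemma sl_res_is_linear M lam : linear (slres M lam).
Proof.
move=> a u v; apply/rowP => j; rewrite /sl_res /ysq !mxE.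
case: ifP => _; first by rewrite !big_ord_recl !big_ord0 !mxE /=; ring.
case: ifP => _; first by rewrite !big_ord_recl !big_ord0 !mxE /=; ring.
by ring.
Qed.

Lemma sub_ker_sl_res M lam y :
  (y <= kermx (lin1_mx (slres M lam)))%MS =
  (slres M lam y == 0).
Proof.
pose lin := GRing.isLinear.Build _ _ _ _ _ (sl_res_is_linear M lam).
pose g : {linear 'rV[C]_N.+2 -> 'rV[C]_N.+2} := HB.pack (slres M lam) lin.
by rewrite (sameP sub_kermxP eqP) -[slres M lam]/(g : _ -> _) mul_rV_lin1.
Qed.

(* The forms are written in the interior unknowns [y_1 .. y_N], so that index
   [i : 'I_N] stands for [y_i.+1]. *)
Definition interior : 'M[C]_(N.+2, N) :=
  colsub (fun j : 'I_N => inord j.+1) 1%:M.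

(** Right multiplication by [ends] reads off [(y_1, y_N)]; the transpose extends a pair of end
    values by zero, so [ends *m beta *m ends^T] is a boundary form seen on [C^N]. *)
Definition ends : 'M[C]_(N, 2) :=
  colsub (fun j : 'I_2 => if j == 0 then ord0 else ord_max) 1%:M.

(* The matrix of [y |-> - nabla (f Delta y) + q y] for Neumann end conditions
   [f_0 Delta y_0 = f_N Delta y_N = 0]. *)
Definition neumann_mx : 'M[C]_N := \matrix_(i, j) rC (
  (i == j :> nat)%:R * (q j.+1 + (j < n.+1)%:R * f j.+1 + (0 < j)%:R * f j)
  - (i == j.+1 :> nat)%:R * f i - (j == i.+1 :> nat)%:R * f j).

Definition weight : 'rV[C]_N := \row_i rC (w i.+1).

Lemma mul_interior (y : 'rV[C]_N.+2) :
  y *m interior = \row_(j < N) ysq y j.+1.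
Proof. by rewrite mulmx_colsub mulmx1; apply/rowP => j; rewrite !mxE. Qed.

Lemma mul_ends k (v : 'M[C]_(k, N)) i : 
  row i (v *m ends) = row2 (v i ord0) (v i ord_max).
Proof.
by rewrite mulmx_colsub mulmx1; apply/rowP => j; rewrite !mxE; case: ifP.
Qed.

Lemma ends_conj : ends^t* = ends^T.
Proof.
by apply/matrixP => i j; rewrite !mxE; case: (_ == _); rewrite ?rmorph1 ?rmorph0.
Qed.

Lemma tr_ends_conj : ends^T^t* = ends.
Proof. by rewrite -ends_conj trmxCK. Qed.

Lemma tr_ends_ends : ends^T *m ends = 1%:M.
Proof.
apply/row_matrixP => i; rewrite mul_ends; apply/rowP => j; rewrite !mxE.
by case: (unliftP 0 i) => [k|] ->; case: (unliftP 0 j) => [l|] -> //;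
  rewrite ?ord1 //= ?eqxx.
Qed.

Lemma row2_tr_ends a b (i : 'I_N) :
  (row2 a b *m ends^T) 0 i = (i == 0 :> nat)%:R * a + (i == n.+1 :> nat)%:R * b.
Proof.
rewrite mxE !big_ord_recl big_ord0 addr0 !mxE /= -!val_eqE /=.
by rewrite !(mulrC _%:R).
Qed.

Lemma sum_pick m k (g : nat -> C) :
  \sum_(i < m) (i == k :> nat)%:R * g i = (k < m)%:R * g k.
Proof.
have [km|mk] := ltnP k m.
  rewrite (bigD1 (Ordinal km)) //= eqxx big1 ?addr0 // => i /negP ik.
  by case: eqP => [e|]; [case: ik; apply/eqP/val_inj | rewrite mul0r].
rewrite mul0r big1 // => i _; case: eqP => [e|]; last by rewrite mul0r.
by have := ltn_ord i; rewrite e ltnNge mk.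
Qed.

Lemma mul_neumann (g : nat -> C) (j : 'I_N) :
  ((\row_(i < N) g i) *m neumann_mx) 0 j =
  (rC (q j.+1) + (j < n.+1)%:R * rC (f j.+1) + (0 < j)%:R * rC (f j)) * g j
  - (j < n.+1)%:R * rC (f j.+1) * g j.+1 - (0 < j)%:R * rC (f j) * g j.-1.
Proof.
pose c := rC (q j.+1) + (j < n.+1)%:R * rC (f j.+1) + (0 < j)%:R * rC (f j).
transitivity (\sum_(i < N) ((i == j :> nat)%:R * (c * g i)
   - (i == j.+1 :> nat)%:R * (rC (f i) * g i)
   - (i == j.-1 :> nat)%:R * ((0 < j)%:R * (rC (f j) * g i)))).
  rewrite mxE; apply: eq_bigr => i _; rewrite !mxE.
  have -> : (j == i.+1 :> nat)%:R = (i == j.-1 :> nat)%:R * (0 < j)%:R :> R.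
    rewrite -natrM mulnb; congr (_%:R); congr nat_of_bool.
    by case: (nat_of_ord j) => [|j'] /=; rewrite ?andbF // andbT eqSS eq_sym.
  rewrite /c !(rmorphB, rmorphD, rmorphM, rmorph_nat).
  ring.
rewrite !sumrB (sum_pick _ _ (fun i => c * g i)).
rewrite (sum_pick _ _ (fun i => rC (f i) * g i)).
rewrite (sum_pick _ _ (fun i => (0 < j)%:R * (rC (f j) * g i))).
have -> : (j < N)%N by [].
have -> : (j.-1 < N)%N by apply: leq_ltn_trans (leq_pred _) _.
by rewrite [(j.+1 < N)%N]ltnS /c /=; ring.
Qed.

Lemma neumann_herm : neumann_mx^t* = neumann_mx.
Proof.
apply/matrixP => i j; rewrite !mxE.
rewrite conj_Creal; last by rewrite complex_real.
congr rC.
have [ij|ij] := eqVneq (i : nat) j.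
  by rewrite ij.
rewrite !mul0r; lra.
Qed.

Definition bc_col (x p y p' : C) : 'cV[C]_4 := \col_(j < 4) nth 0 [:: x; p; y; p'] j.

(** [neumann_mx] omits the end fluxes [p] and [p'], which therefore reappear as sources at the first
    and last nodes; these are distinct because [N >= 2]. *)
Lemma sl_res0P M lam (y : 'rV[C]_N.+2) :
  let p := rC (f 0%N) * (ysq y 1 - ysq y 0) in
  let p' := rC (f N) * (ysq y N.+1 - ysq y N) in
  slres M lam y = 0 <->
  M *m bc_col (ysq y 0) p (ysq y N) p' = 0 /\
  y *m interior *m (neumann_mx - lam *: diag_mx weight) =
    - (row2 p (- p') *m ends^T).
Proof.
move=> p p'.
have mid (i : 'I_N) : (y *m interior *m (neumann_mx - lam *: diag_mx weight)
    + row2 p (- p') *m ends^T) 0 i =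
    - (rC (f i.+1) * (ysq y i.+2 - ysq y i.+1) - rC (f i) * (ysq y i.+1 - ysq y i))
    + rC (q i.+1) * ysq y i.+1 - lam * rC (w i.+1) * ysq y i.+1.
  rewrite mxE row2_tr_ends mulmxBr mul_interior -scalemxAr mul_mx_diag.
  rewrite [X in X + _ = _]mxE (mul_neumann (fun i => ysq y i.+1)) !mxE.
  have := ltn_ord i; rewrite /p /p'; move: (nat_of_ord i) => k kN.
  have [->|k0] := eqVneq k 0%N; first by rewrite /=; ring.
  rewrite lt0n k0 prednK ?lt0n //.
  have [->|k1] := eqVneq k n.+1; first by rewrite ltnn /=; ring.
  have -> : (k < n.+1)%N by lia.
  by rewrite /=; ring.
split=> [y0|[bc0 int0]].
  split.
    apply/colP => i; rewrite [RHS]mxE; case: (unliftP 0 i) => [k|] ->.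
      move/rowP/(_ ord_max): y0; rewrite [LHS]mxE /= eqxx [RHS]mxE => <-.
      by rewrite ord1; congr (_ _ _); apply/val_inj.
    by move/rowP/(_ ord0): y0; rewrite [LHS]mxE /= [RHS]mxE => <-.
  apply/eqP; rewrite -addr_eq0; apply/eqP/rowP => i; rewrite mid [RHS]mxE.
  have iN : (i.+1 < N.+2)%N by rewrite ltnS ltnW // ltnS.
  move/rowP/(_ (Ordinal iN)): y0; rewrite [LHS]mxE /= [RHS]mxE => <-.
  by rewrite eqSS ltn_eqF.
apply/rowP => j; rewrite [LHS]mxE [RHS]mxE.
case: eqP => [_|/eqP j0]; first by rewrite bc0 mxE.
case: eqP => [_|/eqP j1]; first by rewrite bc0 mxE.
have jN : (j.-1 < N)%N by have := ltn_ord j; lia.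
have := mid (Ordinal jN); rewrite int0 addNr mxE /= prednK ?lt0n // => ->.
Qed.

(* A self-adjoint boundary condition as a Lagrangian relation between the end
   values [u = (y_1, y_N)] and the fluxes [(f_0 Delta y_0, - f_N Delta y_N)]:
   [u] lies in the left kernel of [L], on which the fluxes are given by the
   form [beta]. *)
Definition bc_form r (M : 'M[C]_(2, 4)) (L : 'M[C]_(2, r)) (beta : 'M[C]_2) :=
  forall x p y p', M *m bc_col x p y p' = 0 <->
    let u := row2 (x + p / rC (f 0%N)) y in
    u *m L = 0 /\
    forall z : 'rV[C]_2, z *m L = 0 ->
      row2 p (- p') *m z^t* = u *m beta *m z^t*.

Definition bc_space r (L : 'M[C]_(2, r)) : 'M[C]_N := kermx (ends *m L).

Definition bc_mx (beta : 'M[C]_2) : 'M[C]_N :=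
  neumann_mx + ends *m beta *m ends^T.

Lemma bc_space_rank r (L : 'M[C]_(2, r)) : \rank (bc_space L) = (N - \rank L)%N.
Proof.
rewrite mxrank_ker eqmxMfull //; apply/row_fullP.
by exists ends^T; exact: tr_ends_ends.
Qed.

Lemma bc_mx_herm beta : beta^t* = beta -> (bc_mx beta)^t* = bc_mx beta.
Proof.
move=> bh; rewrite linearD map_mxD neumann_herm !trmxC_mul bh.
by rewrite tr_ends_conj ends_conj mulmxA.
Qed.

Hypothesis fN0 : forall k, (k <= N)%N -> f k != 0.

Lemma rC_eq0 (x : R) : (rC x == 0) = (x == 0).
Proof. by rewrite eq_complex /= eqxx andbT. Qed.

(** Restriction to the interior maps the solution space isomorphically onto the vectors of
    [bc_space L] that [bc_mx beta - lam W] sends to vectors orthogonal to that space: the equations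
    at the end nodes give the fluxes, and as [f_0] and [f_N] are nonzero the fluxes give [y_0] and
    [y_(N+1)]. *)
Lemma sl_mult_form r M (L : 'M[C]_(2, r)) beta lam :
  bc_form M L beta ->
  sl_mult N f q w M lam =
  \rank (bc_space L :&: kermx ((bc_mx beta - lam *: diag_mx weight) *m
                               (bc_space L)^t*))%MS.
Proof.
move=> bcM; rewrite /sl_mult.
set A := kermx _; set V := bc_space L; set T := neumann_mx - lam *: diag_mx weight.
have AP y : (y <= A)%MS <-> slres M lam y = 0.
  by rewrite sub_ker_sl_res; split=> /eqP.
have VP k (v : 'M_(k, N)) : (v <= V)%MS <-> v *m ends *m L = 0.
  by rewrite -mulmxA; split=> /sub_kermxP.
have QT v : v *m (bc_mx beta - lam *: diag_mx weight) =
    v *m T + v *m ends *m beta *m ends^T :> 'rV_N.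
  by rewrite /bc_mx addrAC mulmxDr !mulmxA.
have f0 : rC (f 0%N) != 0 by rewrite rC_eq0 fN0.
have f1 : rC (f N) != 0 by rewrite rC_eq0 fN0.
have endsY y : y *m interior *m ends = row2 (ysq y 1) (ysq y N).
  rewrite -[LHS](row_id 0) mul_ends mul_interior !mxE.
  by congr row2.
have Y1E y : ysq y 1 = ysq y 0 + rC (f 0%N) * (ysq y 1 - ysq y 0) / rC (f 0%N).
  by field.
have <- : \rank (A *m interior) = \rank A.
  apply/mxrank_injP/eqP; apply/eqP; rewrite -submx0; apply/rV_subP => y.
  rewrite sub_capmx submx0 => /andP[/AP /sl_res0P[_ yT] /sub_kermxP yi].
  move: yT; rewrite yi mul0mx => /eqP; rewrite eq_sym oppr_eq0 => /eqP p0.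
  have yk k : (0 < k <= N)%N -> ysq y k = 0.
    move=> /andP[k0 kN]; have kN' : (k.-1 < N)%N by lia.
    by move/rowP/(_ (Ordinal kN')): yi; rewrite mul_interior !mxE /= prednK.
  have y0 : ysq y 0 = 0.
    move/rowP/(_ ord0): p0; rewrite row2_tr_ends mxE /= mul1r mul0r addr0.
    by move/eqP; rewrite mulf_eq0 (negPf f0) yk //= sub0r oppr_eq0 => /eqP.
  have yN : ysq y N.+1 = 0.
    move/rowP/(_ ord_max): p0; rewrite row2_tr_ends mxE /= eqxx mul1r mul0r add0r.
    move/eqP; rewrite oppr_eq0 mulf_eq0 (negPf f1) (yk N) ?leqnn //= subr0.
    by move/eqP.
  apply/eqP/rowP => j; rewrite [RHS]mxE -[j]inord_val -/(ysq y j).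
  have [->//|j0] := eqVneq (j : nat) 0%N.
  have [->//|j1] := eqVneq (j : nat) N.+1.
  by apply: yk; have := ltn_ord j; lia.
apply/eqmx_rank/andP; split; apply/rV_subP => v.
  case/submxP => a ->; rewrite mulmxA; have := submxMl a A.
  move: (a *m A) => y /AP /sl_res0P[/bcM[uL uz] yT].
  rewrite sub_capmx; rewrite -Y1E -endsY in uL uz.
  apply/andP; split; first exact/VP.
  apply/sub_kermxP; rewrite mulmxA QT yT mulmxDl mulNmx addrC.
  rewrite -!mulmxA -ends_conj -trmxC_mul !mulmxA.
  rewrite -mulmxBl; apply: mul_trmxC_eq0 => j.
  rewrite mulmxBl uz ?subrr // -row_mul.
  by have /VP -> := submx_refl V; rewrite row0.
rewrite sub_capmx => /andP[/VP vL /sub_kermxP]; rewrite mulmxA => vK.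
have vZ k (Z : 'M_(k, N)) : Z *m ends *m L = 0 ->
    (v *m T + v *m ends *m beta *m ends^T) *m Z^t* = 0.
  by move=> /VP /submxP[D ->]; rewrite trmxC_mul mulmxA -QT vK mul0mx.
(* The fluxes are read off from the equations at the first and last nodes; [y_0] and [y_(N+1)] are
   then chosen to realize them. *)
pose p := - (v *m T) 0 ord0; pose p' := (v *m T) 0 ord_max.
pose y : 'rV[C]_N.+2 := \row_j
  if (j : nat) == 0%N then v 0 ord0 - p / rC (f 0%N)
  else if (j : nat) == N.+1 then v 0 ord_max + p' / rC (f N)
  else v 0 (inord j.-1).
have yv : y *m interior = v.
  rewrite mul_interior; apply/rowP => j; rewrite /ysq !mxE inordK; last first.
    by rewrite ltnS ltnW // ltnS.
  by rewrite /= eqSS ltn_eqF // inord_val.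
rewrite -yv; apply: submxMr; apply/AP/sl_res0P.
have y0 : ysq y 0 = v 0 ord0 - p / rC (f 0%N).
  by rewrite /ysq mxE inordK.
have y1 : ysq y 1 = v 0 ord0.
  by move/rowP/(_ ord0): yv; rewrite mul_interior mxE.
have yN : ysq y N = v 0 ord_max.
  by move/rowP/(_ ord_max): yv; rewrite mul_interior mxE.
have yN1 : ysq y N.+1 = v 0 ord_max + p' / rC (f N).
  by rewrite /ysq mxE inordK //= eqxx.
have -> : rC (f 0%N) * (ysq y 1 - ysq y 0) = p by rewrite y0 y1; field.
have -> : rC (f N) * (ysq y N.+1 - ysq y N) = p' by rewrite yN yN1; field.
have vE : row2 (v 0 ord0) (v 0 ord_max) = v *m ends.
  by rewrite -mul_ends row_id.
split.
  apply/bcM; rewrite y0 subrK yN vE; split=> // z zL.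
  have := vZ _ (z *m ends^T); rewrite -(mulmxA z) tr_ends_ends mulmx1 => /(_ zL).
  rewrite trmxC_mul tr_ends_conj mulmxA mulmxDl -(mulmxA _ (ends^T)).
  rewrite tr_ends_ends mulmx1 mulmxDl => /eqP; rewrite addrC addr_eq0.
  move/eqP->; rewrite -mulNmx; congr (_ *m _).
  rewrite -[v *m T *m ends](row_id 0) mul_ends /p /p'.
  by apply/rowP => j; rewrite !mxE; case: ifP.
rewrite yv; apply/rowP => i; rewrite [RHS]mxE row2_tr_ends.
have [i0|i0] := eqVneq (i : nat) 0%N.
  rewrite i0 mul1r mul0r addr0 opprK; congr (_ _ _); exact/val_inj.
have [i1|i1] := eqVneq (i : nat) n.+1.
  rewrite mul0r mul1r add0r opprK; congr (_ _ _); exact/val_inj.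
rewrite !mul0r addr0 oppr0.
(* A coordinate vector at any other node has zero end values, so it lies in [bc_space L], and
   testing against it gives the equation at that node. *)
have ei : (delta_mx 0 i : 'rV[C]_N) *m ends = 0.
  rewrite -[LHS](row_id 0) mul_ends !mxE -!val_eqE /= ![_ == nat_of_ord i]eq_sym.
  rewrite (negPf i0) (negPf i1); by apply/rowP=> j; rewrite !mxE if_same.
have := vZ 1%N (delta_mx 0 i); rewrite ei mul0mx => /(_ erefl).
rewrite mulmxDl -(mulmxA _ (ends^T)) -ends_conj -trmxC_mul ei trmx0 map_mx0 mulmx0 addr0.
move/rowP/(_ 0); rewrite mxE [RHS]mxE (bigD1 i) //= big1 ?addr0.
  by rewrite !mxE !eqxx rmorph1 mulr1.
by move=> k ki; rewrite !mxE (negPf ki) rmorph0 mulr0.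
Qed.

End Reduction.

(** * Spectra attached to a boundary form, and their comparison *)

Section Spectra.
Variable R : realType.
Local Notation C := R[i].
Variables (n : nat) (f q w : nat -> R).
Local Notation N := n.+2.
Hypothesis fN0 : forall k, (k <= N)%N -> f k != 0.
Hypothesis w0 : forall k, (1 <= k <= N)%N -> 0 < w k.

Definition bc_spectrum r (L : 'M[C]_(2, r)) (beta : 'M[C]_2) (s : seq R) :=
  exists E : 'M_(\rank (bc_space n L), N),
    eigenbasis (diag_mx (weight n w)) (bc_mx n f q beta) (bc_space n L) s E.

Lemma bc_spectrum_exists r M (L : 'M[C]_(2, r)) beta :
  bc_form f M L beta -> beta^t* = beta ->
  exists s, [/\ bc_spectrum L beta s, eig_list N f q w M s &
                size s = (N - \rank L)%N].
Proof.
move=> bcM bh.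
have wpos i : 0 < weight n w 0 i by rewrite mxE ltcR w0 //= ltn_ord.
have [s [E B]] := eigenbasis_exists (bc_space n L) wpos (bc_mx_herm n f q bh).
have [zs so _ _ _] := B.
exists s; split; [by exists E| |by rewrite zs bc_space_rank].
by split=> // lam; rewrite (sl_mult_form _ _ _ _ bcM) // (eigenbasis_mult _ B).
Qed.

(** The Neumann part is common to both forms, so only the boundary forms on [C^2] need comparing.
    The dimension condition of [eigenbasis_le] becomes the last hypothesis once [N] cancels; the two
    strict bounds keep both indices inside the lists, so the default of [nth] never enters. *)
Lemma bc_spectrum_le r1 r2 r (L1 : 'M[C]_(2, r1)) (L2 : 'M[C]_(2, r2))
    (L : 'M[C]_(2, r)) beta1 beta2 s1 s2 i j :
  bc_spectrum L1 beta1 s1 -> bc_spectrum L2 beta2 s2 ->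
  (forall u : 'rV_2, u *m L = 0 -> [/\ u *m L1 = 0, u *m L2 = 0 &
     (u *m beta1 *m u^t*) 0 0 <= (u *m beta2 *m u^t*) 0 0]) ->
  (i + \rank L1 < N)%N -> (j + \rank L2 < N)%N ->
  (i + \rank L <= j + \rank L2)%N -> s1`_i <= s2`_j.
Proof.
move=> [E1 B1] [E2 B2] LL i1 j2 ij.
have rL := rank_leq_row L; have rL2 := rank_leq_row L2.
have XP (v : 'rV_N) : (v <= bc_space n L)%MS -> [/\ v *m ends R n *m L1 = 0,
    v *m ends R n *m L2 = 0 &
    (v *m ends R n *m beta1 *m (v *m ends R n)^t*) 0 0 <=
    (v *m ends R n *m beta2 *m (v *m ends R n)^t*) 0 0].
  by move=> /sub_kermxP; rewrite mulmxA => /LL.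
apply: (eigenbasis_le (X := bc_space n L) B1 B2).
- apply/rV_subP => v /XP[vL _ _]; apply/sub_kermxP; by rewrite mulmxA.
- apply/rV_subP => v /XP[_ vL _]; apply/sub_kermxP; by rewrite mulmxA.
- move=> v /XP[_ _ le12].
  have formE beta : (v *m bc_mx n f q beta *m v^t*) 0 0 =
      (v *m neumann_mx n f q *m v^t*) 0 0 +
      (v *m ends R n *m beta *m (v *m ends R n)^t*) 0 0.
    by rewrite mulmxDr mulmxDl [LHS]mxE trmxC_mul ends_conj !mulmxA.
  by rewrite !formE lerD2l.
- by rewrite bc_space_rank; lia.
- by rewrite bc_space_rank; lia.
- by rewrite !bc_space_rank; lia.
Qed.

End Spectra.

(** * Boundary forms of the conditions [e^(i gamma) K], [T_K] and [U_K] *)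

Section BoundaryForms.
Variable R : realType.
Local Notation C := R[i].

Definition mx22 (a b c d : C) : 'M[C]_2 :=
  \matrix_i row2 (if i == 0 then a else c) (if i == 0 then b else d).

Definition col2 (a b : C) : 'cV[C]_2 := (row2 a b)^T.

Lemma row2_mx22 (x y a b c d : C) :
  row2 x y *m mx22 a b c d = row2 (x * a + y * c) (x * b + y * d).
Proof.
by apply/rowP => j; rewrite !mxE !big_ord_recl big_ord0 addr0 !mxE /=; case: ifP.
Qed.

Lemma row2_dot (x y z t : C) : row2 x y *m (row2 z t)^t* = (x * z^* + y * t^*)%:M.
Proof.
apply/matrixP => i j; rewrite !ord1 !mxE !big_ord_recl big_ord0 addr0 !mxE /=.
by rewrite mulr1n.
Qed.

Lemma row2_col2 (x y a b : C) : row2 x y *m col2 a b = (x * a + y * b)%:M.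
Proof.
apply/matrixP => i j; rewrite !ord1 !mxE !big_ord_recl big_ord0 addr0 !mxE /=.
by rewrite mulr1n.
Qed.

Lemma scalar1_inj (x y : C) : x%:M = y%:M :> 'M[C]_1 <-> x = y.
Proof.
split=> [/matrixP/(_ 0 0)|->//]; by rewrite !mxE !mulr1n.
Qed.

Lemma row2_col2_eq0 (x y a b : C) : row2 x y *m col2 a b = 0 <-> x * a + y * b = 0.
Proof. by rewrite row2_col2 -scalar1_inj (raddf0 scalar_mx). Qed.

Lemma rank_col2_le (a b : C) : (\rank (col2 a b) <= 1)%N.
Proof. exact: rank_leq_col. Qed.

Lemma rank_col2 (a b : C) : b != 0 -> \rank (col2 a b) = 1%N.
Proof.
move=> b0; rewrite mxrank_tr rank_rV; case: eqP => // /rowP/(_ 1).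
by rewrite !mxE /= => /eqP; rewrite (negPf b0).
Qed.

Lemma mx22_herm (a b c d : C) : a^* = a -> b^* = c -> d^* = d ->
  (mx22 a b c d)^t* = mx22 a b c d.
Proof.
move=> ha hb hd; have hc : c^* = b by rewrite -hb conjCK.
apply/matrixP => i j; rewrite !mxE.
by case: (i == 0); case: (j == 0).
Qed.

Lemma mx2x4_bc (a0 a1 a2 a3 b0 b1 b2 b3 x p y p' : C) :
  mx2x4 [:: a0; a1; a2; a3] [:: b0; b1; b2; b3] *m bc_col x p y p' = 0 <->
  a0 * x + a1 * p + a2 * y + a3 * p' = 0 /\
  b0 * x + b1 * p + b2 * y + b3 * p' = 0.
Proof.
split=> [/colP h|[ha hb]].
  have := h 0; have := h 1; rewrite !mxE !big_ord_recl !big_ord0 !mxE /= !addr0 !addrA.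
  by move=> -> ->.
apply/colP => i; rewrite !mxE !big_ord_recl !big_ord0 !mxE /= !addr0 !addrA.
by case: ifP.
Qed.

Lemma bc_formP (f : nat -> R) r M (L : 'M[C]_(2, r)) (b11 b12 b21 b22 : C) :
  (forall x p y p', M *m bc_col x p y p' = 0 <->
    let u := x + p / rC (f 0%N) in
    row2 u y *m L = 0 /\
    forall z t, row2 z t *m L = 0 ->
      p * z^* - p' * t^* =
      (u * b11 + y * b21) * z^* + (u * b12 + y * b22) * t^*) ->
  bc_form f M L (mx22 b11 b12 b21 b22).
Proof.
move=> h x p y p'; rewrite h /=; split=> -[uL uz]; split=> //.
  move=> z; rewrite (row2E z) => zL.
  by rewrite row2_mx22 !row2_dot mulNr uz.
move=> z t zL; have := uz _ zL; rewrite row2_mx22 !row2_dot => /scalar1_inj.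
by rewrite mulNr.
Qed.

(** The [lincomb] lemmas certify an equation by explicit multipliers of expressions known to vanish,
    leaving an identity for [ring] or [field]. *)
Lemma lincomb1 (k l A B : C) : l = 0 -> A - B = k * l -> A = B.
Proof. by move=> -> /eqP; rewrite mulr0 subr_eq0 => /eqP. Qed.

Lemma lincomb2 (k k' l l' A B : C) :
  l = 0 -> l' = 0 -> A - B = k * l + k' * l' -> A = B.
Proof. by move=> -> -> /eqP; rewrite !mulr0 addr0 subr_eq0 => /eqP. Qed.

Lemma lincomb3 (k1 k2 k3 l1 l2 l3 A B : C) : l1 = 0 -> l2 = 0 -> l3 = 0 ->
  A - B = k1 * l1 + k2 * l2 + k3 * l3 -> A = B.
Proof. by move=> -> -> -> /eqP; rewrite !mulr0 !addr0 subr_eq0 => /eqP. Qed.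

Lemma subr0_eq0 (x y : C) : x = y -> x - y = 0.
Proof. by move=> ->; rewrite subrr. Qed.

Variables (f : nat -> R) (a b c d e : C).
Local Notation F := (rC (f 0%N)).
Hypotheses (F0 : F != 0) (det1 : a * d - b * c = 1) (ee : e * e^* = 1).
Hypothesis a_real : a^* = a.
Local Notation D := (a - F * b).

(** Here [a, b, c, d] are the entries of [K], [e] is [e^(i gamma)] and [D] is [k11 - f_0 k12].
    Putting [x = u - p / F] in [y = e (a x + b p)] gives [p = F (a u - e^* y) / D], the first
    column; the second expresses [- p'] likewise. *)
Definition beta_K : 'M[C]_2 :=
  mx22 (F * a / D) (- (e * F / D)) (- (e^* * F / D)) ((d * F - c) / D).
Definition beta_T : 'M[C]_2 := mx22 0 0 0 (- (c / a)).

Let MK := mx2x4 [:: e * a; e * b; -1; 0] [:: e * c; e * d; 0; -1].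
Let MT : 'M[C]_(2, 4) := mx2x4 [:: 0; 1; 0; 0] [:: 0; 0; - c; a].
Let MU : 'M[C]_(2, 4) := mx2x4 [:: a; b; 0; 0] [:: 0; 0; 1; 0].

Let e0 : e != 0.
Proof. by apply/eqP => e0; move/eqP: ee; rewrite e0 mul0r eq_sym oner_eq0. Qed.
Let eV : e^* = e^-1.
Proof. by apply: (mulfI e0); rewrite ee divff. Qed.

Let detE : a * d - b * c - 1 = 0.
Proof. by rewrite det1 subrr. Qed.

(** For nonzero [D] the end values are free, which the zero constraint matrix encodes; testing with
    the two unit vectors recovers both boundary equations. *)
Lemma bc_form_K1 : D != 0 -> bc_form f MK (0 : 'M[C]_(2, 1)) beta_K.
Proof.
move=> D0; apply: bc_formP => x p y p'; rewrite mx2x4_bc eV /=; split.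
  move=> [E1 E2]; split=> [|z t _]; first by rewrite mulmx0.
  have -> : y = e * a * x + e * b * p by apply: (lincomb1 (k := -1) E1); ring.
  have -> : p' = e * c * x + e * d * p by apply: (lincomb1 (k := -1) E2); ring.
  apply: (lincomb1 (k := - (e / D * (F * x + p) * t^*)) detE).
  by field; rewrite ?F0 ?D0 ?e0.
move=> [_ H].
have := H 1 0; rewrite mulmx0 rmorph1 rmorph0 => /(_ erefl) /subr0_eq0 H1.
have := H 0 1; rewrite mulmx0 rmorph1 rmorph0 => /(_ erefl) /subr0_eq0 H2.
have E1 : e * a * x + e * b * p + -1 * y + 0 * p' = 0.
  by apply: (lincomb1 (k := - (e * D / F)) H1); field; rewrite ?F0 ?D0 ?e0.
split=> //.
apply: (lincomb3 (k1 := (d * F - c) / D * -1) (k2 := 1)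
  (k3 := e / D * (F * x + p)) E1 H2 detE).
by field; rewrite ?F0 ?D0 ?e0.
Qed.

(** For [D = 0] the first equation becomes [y = e a (x + p / F)], a constraint on end values alone.
    On that line the second one, with [d = 1 / a + c / F], prescribes the flux given by [beta_T]. *)
Lemma bc_form_K0 : a != 0 -> D = 0 ->
  bc_form f MK (col2 (e * a) (-1)) beta_T.
Proof.
move=> a0 D0; apply: bc_formP => x p y p'.
have bE : b = a / F by apply: (lincomb1 (k := - F^-1) D0); field.
have dE : d = a^-1 + c / F.
  by apply: (lincomb1 (k := a^-1) detE); rewrite bE; field; rewrite ?F0 ?a0.
rewrite mx2x4_bc /= row2_col2_eq0 bE dE; split.
  move=> [E1 E2]; have Ey : y = e * a * (x + p / F).
    by apply: (lincomb1 (k := -1) E1); field.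
  split=> [|z t]; first by rewrite Ey; field.
  rewrite row2_col2_eq0 => zt; have -> : t = e * a * z.
    by apply: (lincomb1 (k := -1) zt); ring.
  rewrite !rmorphM /= a_real eV.
  have -> : p' = e * (c * x + (a^-1 + c / F) * p).
    by apply: (lincomb1 (k := -1) E2); field; rewrite ?F0 ?a0.
  by rewrite Ey; field; rewrite ?F0 ?a0 ?e0.
move=> [uL H]; have E1 : e * a * x + e * (a / F) * p + -1 * y + 0 * p' = 0.
  by apply: (lincomb1 (k := 1) uL); field.
split=> //.
have := H 1 (e * a); rewrite row2_col2_eq0 !rmorphM rmorph1 /= a_real eV.
have -> : 1 * (e * a) + e * a * -1 = 0 by ring.
move=> /(_ erefl) /subr0_eq0 H1.
apply: (lincomb2 (k := e / a) (k' := c / a) H1 E1).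
by field; rewrite ?F0 ?a0 ?e0.
Qed.

Lemma bc_form_T1 : a != 0 -> bc_form f MT (0 : 'M[C]_(2, 1)) beta_T.
Proof.
move=> a0; apply: bc_formP => x p y p'; rewrite mx2x4_bc /=; split.
  move=> [E1 E2]; split=> [|z t _]; first by rewrite mulmx0.
  have -> : p = 0 by apply: (lincomb1 (k := 1) E1); ring.
  have -> : p' = c / a * y by apply: (lincomb1 (k := a^-1) E2); field.
  by ring.
move=> [_ H].
have := H 1 0; rewrite mulmx0 rmorph1 rmorph0 => /(_ erefl) /subr0_eq0 H1.
have := H 0 1; rewrite mulmx0 rmorph1 rmorph0 => /(_ erefl) /subr0_eq0 H2.
split; first by apply: (lincomb1 (k := 1) H1); ring.
by apply: (lincomb1 (k := - a) H2); field; rewrite ?F0 ?a0.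
Qed.

(** For [a = 0] the determinant makes [c] nonzero, so [T_K] reads [p = 0], [y = 0]; the corner entry
    [F a / D] of [beta_K] vanishes as well and prescribes the same zero flux. *)
Lemma bc_form_T0 : a = 0 -> bc_form f MT (col2 0 1) beta_K.
Proof.
move=> a0; apply: bc_formP => x p y p'; rewrite mx2x4_bc /= row2_col2_eq0.
have c0 : c != 0.
  apply/eqP => c0; have := det1; rewrite a0 c0 mul0r mulr0 subrr => /eqP.
  by rewrite eq_sym oner_eq0.
split.
  move=> [E1 E2].
  have -> : y = 0.
    by apply: (mulfI c0); apply: (lincomb1 (k := -1) E2); rewrite a0; ring.
  have -> : p = 0 by apply: (lincomb1 (k := 1) E1); ring.
  split=> [|z t]; first by ring.
  rewrite row2_col2_eq0 => zt; have -> : t = 0 by rewrite -zt; ring.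
  by rewrite rmorph0 a0; ring.
move=> [uL H]; have y0 : y = 0 by rewrite -uL; ring.
have := H 1 0; rewrite row2_col2_eq0 rmorph1 rmorph0 mulr0 mul0r addr0.
move=> /(_ erefl) /subr0_eq0; rewrite y0 a0 => H1.
by split; first (apply: (lincomb1 (k := 1) H1)); ring.
Qed.

Lemma bc_form_U1 : D != 0 -> bc_form f MU (col2 0 1) beta_K.
Proof.
move=> D0; apply: bc_formP => x p y p'; rewrite mx2x4_bc /= row2_col2_eq0.
split.
  move=> [E1 E2].
  have -> : y = 0 by apply: (lincomb1 (k := 1) E2); ring.
  split=> [|z t]; first by ring.
  rewrite row2_col2_eq0 => zt; have -> : t = 0 by rewrite -zt; ring.
  rewrite rmorph0; apply: (lincomb1 (k := - (F / D * z^*)) E1).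
  by field; rewrite ?F0 ?D0.
move=> [uL H]; have y0 : y = 0 by rewrite -uL; ring.
have := H 1 0; rewrite row2_col2_eq0 rmorph1 rmorph0 mulr0 mul0r addr0.
move=> /(_ erefl) /subr0_eq0; rewrite y0 => H1.
split; last by ring.
by apply: (lincomb1 (k := - (D / F)) H1); field; rewrite ?F0 ?D0.
Qed.

(** For [D = 0] one has [a x + b p = a (x + p / F)], so both end values vanish and the fluxes are
    free. *)
Lemma bc_form_U0 : a != 0 -> D = 0 -> bc_form f MU 1%:M beta_T.
Proof.
move=> a0 D0; apply: bc_formP => x p y p'; rewrite mx2x4_bc /= mulmx1.
have bE : b = a / F by apply: (lincomb1 (k := - F^-1) D0); field.
have row20 : (0 : 'rV[C]_2) = row2 0 0 by apply/rowP => j; rewrite !mxE if_same.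
rewrite row20; split.
  move=> [E1 E2]; split.
    apply/row2_eq; split; last by apply: (lincomb1 (k := 1) E2); ring.
    by apply: (lincomb1 (k := a^-1) E1); rewrite bE; field; rewrite ?F0 ?a0.
  move=> z t; rewrite mulmx1 => /row2_eq[-> ->]; rewrite rmorph0; ring.
move=> [/row2_eq[u0 ->] _]; split; last by ring.
by apply: (lincomb1 (k := a) u0); rewrite bE; field.
Qed.

Hypotheses (b_real : b^* = b) (c_real : c^* = c) (d_real : d^* = d).
Let F_real : F^* = F.
Proof. by rewrite conj_Creal // complex_real. Qed.

Lemma beta_K_herm : beta_K^t* = beta_K.
Proof.
by apply: mx22_herm; rewrite !(rmorphM, rmorphN, rmorphB, fmorphV) /=
  ?rmorphM ?conjCK a_real ?b_real ?c_real ?d_real F_real ?rmorphM.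
Qed.

Lemma beta_T_herm : beta_T^t* = beta_T.
Proof.
by apply: mx22_herm; rewrite ?rmorph0 // rmorphN rmorphM fmorphV /= a_real c_real.
Qed.

(** The lower corners differ by [(d F - c) / D + c / a = F (a d - b c) / (D a)]; determinant [1]
    makes the whole difference a multiple of one square. *)
Lemma beta_K_sub_T (u : 'rV[C]_2) : a != 0 -> D != 0 ->
  (u *m beta_K *m u^t*) 0 0 = (u *m beta_T *m u^t*) 0 0 +
     F / (D * a) * `|(u *m col2 a (- e^*)) 0 0| ^+ 2.
Proof.
move=> a0 D0; rewrite (row2E u) !row2_mx22 !row2_dot row2_col2 !mxE !mulr1n normCK.
rewrite !(rmorphD, rmorphM, rmorphN) /= conjCK a_real.
move: (u 0 0) (u 0 1) => s t.
apply: (lincomb1 (k := t * t^* * F / (D * a)) detE).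
have -> : e^* = e^-1 by [].
by field; rewrite ?a0 ?D0 ?e0.
Qed.

End BoundaryForms.

(** * Eigenvalue counts and inequalities, by cases on [k11 - f_0 k12] and [k11] *)

Lemma det_mx22 (F : comNzRingType) (A : 'M[F]_2) :
  \det A = A 0 0 * A 1 1 - A 0 1 * A 1 0.
Proof.
rewrite (expand_det_row _ 0) !big_ord_recl big_ord0 addr0 /cofactor !det_mx11 !mxE.
rewrite expr0 mul1r expr1 mulN1r mulrN; congr (_ * A _ _ - A _ _ * A _ _); exact/val_inj.
Qed.

Theorem theorem3p6 (R : realType) (N : nat) (f q w : nat -> R)
  (K : 'M[R]_2) (gamma : R) :
  (2 <= N)%N ->
  (forall n : nat, (n <= N)%N -> f n != 0) ->
  (forall n : nat, (1 <= n <= N)%N -> 0 < w n) ->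
  \det K = 1 ->
  - pi < gamma <= pi ->
  let k11 := K 0 0 in let k12 := K 0 1 in
  let c := k11 - f 0%N * k12 in
  exists sK sT sU : seq R,
    [/\ eig_list N f q w (bc_EK K gamma) sK,
        eig_list N f q w (bc_T K) sT &
        eig_list N f q w (bc_U K) sU] /\
    [/\ size sK = (if c != 0 then N else (N - 1)%N),
        size sT = (if k11 != 0 then N else (N - 1)%N) &
        size sU = (if c != 0 then (N - 1)%N else (N - 2)%N)] /\
    (* (i) *)
    [/\ 0 < c * k11 * f 0%N ->
          (forall n : nat, (n + 1 <= N)%N -> nth 0 sT n <= nth 0 sK n) /\
          (forall n : nat, (n + 2 <= N)%N -> nth 0 sK n <= nth 0 sT n.+1),
        c * k11 * f 0%N < 0 ->
          (forall n : nat, (n + 1 <= N)%N -> nth 0 sK n <= nth 0 sT n) /\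
          (forall n : nat, (n + 2 <= N)%N -> nth 0 sT n <= nth 0 sK n.+1),
        c = 0 ->
          (forall n : nat, (n + 2 <= N)%N ->
             nth 0 sT n <= nth 0 sK n <= nth 0 sT n.+1) &
        k11 = 0 ->
          (forall n : nat, (n + 2 <= N)%N ->
             nth 0 sK n <= nth 0 sT n <= nth 0 sK n.+1)] /\
    (* (ii) *)
    [/\ c != 0 ->
          (forall n : nat, (n + 2 <= N)%N ->
             nth 0 sK n <= nth 0 sU n <= nth 0 sK n.+1) &
        c = 0 ->
          (forall n : nat, (n + 3 <= N)%N ->
             nth 0 sK n <= nth 0 sU n <= nth 0 sK n.+1)].
Proof.
case: N => [|[|n]] // _ fN0 wpos detK _ k11 k12 c.
pose a := rC k11; pose b := rC k12; pose c' := rC (K 1 0); pose d := rC (K 1 1).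
pose F := rC (f 0%N); pose e := expi gamma.
have F0 : F != 0 by rewrite rC_eq0 fN0.
have det1 : a * d - b * c' = 1.
  by rewrite -!rmorphM -rmorphB -(rmorph1 (@rC R)) -detK det_mx22.
have rC_real (x : R) : (rC x)^* = rC x by rewrite conj_Creal // complex_real.
have ee : e * e^* = 1.
  have -> : e^* = Complex (cos gamma) (- sin gamma) by [].
  apply/eqP; rewrite eq_complex /= mulrN opprK -!expr2 cos2Dsin2 eqxx /=.
  by rewrite mulrN addrC mulrC subrr.
have DE : a - F * b = rC c by rewrite /c rmorphB rmorphM.
have bT := beta_T_herm (rC_real k11) (rC_real (K 1 0)).
have MT : bc_T K = mx2x4 [:: 0; 1; 0; 0] [:: 0; 0; - c'; a] by rewrite -rmorphN.
have r01 : \rank (0 : 'M[R[i]]_(2, 1)) = 0%N by rewrite mxrank0.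
have [c0|c0] := eqVneq c 0.
  (* If [k11] vanished, so would [k12], and [K] would be singular. *)
  have a0 : a != 0.
    rewrite rC_eq0; apply/eqP => k0; have k12z : k12 = 0.
      move/eqP: c0; rewrite /c k0 sub0r oppr_eq0 mulf_eq0 (negPf (fN0 0%N _)) //.
      by move/eqP.
    move/eqP: det1; rewrite /a /b k0 k12z rmorph0 !mul0r subrr eq_sym.
    by rewrite oner_eq0.
  have D0 : a - F * b = 0 by rewrite DE c0.
  (* All three problems now carry the form [beta_T], under nested constraints of rank [1], [0] and
     [2]. *)
  have [sK [specK eigK zK]] := bc_spectrum_exists q fN0 wpos
    (bc_form_K0 F0 det1 ee (rC_real k11) a0 D0) bT.
  have [sT [specT eigT zT]] := bc_spectrum_exists q fN0 wpos
    (bc_form_T1 c' F0 a0) bT.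
  have [sU [specU eigU zU]] := bc_spectrum_exists q fN0 wpos
    (bc_form_U0 c' F0 a0 D0) bT.
  have rK : \rank (col2 (e * a) (-1)) = 1%N.
    by rewrite rank_col2 // oppr_eq0 oner_eq0.
  have r2 : \rank (1%:M : 'M[R[i]]_2) = 2%N by rewrite mxrank1.
  rewrite rK r2 r01 in zK zT zU.
  have k11n : k11 != 0 by rewrite -rC_eq0.
  exists sK, sT, sU; split; first by split; rewrite ?MT.
  split; first by rewrite k11n /= zK zT zU subn0.
  split; split.
  - by rewrite c0 !mul0r ltxx.
  - by rewrite c0 !mul0r ltxx.
  - move=> _ m mN; apply/andP; split.
      apply: (bc_spectrum_le (L := col2 (e * a) (-1)) specT specK);
        rewrite ?rK ?r01; try lia.
      by move=> u uL; split=> //; rewrite mulmx0.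
    apply: (bc_spectrum_le (L := col2 (e * a) (-1)) specK specT);
      rewrite ?rK ?r01; try lia.
    by move=> u uL; split=> //; rewrite mulmx0.
  - by move=> k0; rewrite k0 eqxx in k11n.
  - by [].
  - move=> _ m mN; apply/andP; split.
      apply: (bc_spectrum_le (L := 1%:M) specK specU); rewrite ?rK ?r2; try lia.
      by move=> u; rewrite mulmx1 => ->; rewrite !mul0mx.
    apply: (bc_spectrum_le (L := 1%:M) specU specK); rewrite ?rK ?r2; try lia.
    by move=> u; rewrite mulmx1 => ->; rewrite !mul0mx.
have D0 : a - F * b != 0 by rewrite DE rC_eq0.
have bK := beta_K_herm f e (rC_real k11) (rC_real k12) (rC_real (K 1 0)) (rC_real (K 1 1)).
have [sK [specK eigK zK]] := bc_spectrum_exists q fN0 wpos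
  (bc_form_K1 F0 det1 ee D0) bK.
have [sU [specU eigU zU]] := bc_spectrum_exists q fN0 wpos
  (bc_form_U1 c' d e F0 D0) bK.
have rU : \rank (col2 0 1 : 'cV[R[i]]_2) = 1%N by rewrite rank_col2 // oner_eq0.
rewrite r01 rU in zK zU.
(* [U_K] adds the rank one constraint [y_N = 0] to the same form [beta_K]; this holds whether or not
   [k11] vanishes. *)
have KU m : (m + 2 <= n.+2)%N -> sK`_m <= sU`_m <= sK`_m.+1.
  move=> mN; apply/andP; split.
    apply: (bc_spectrum_le (L := col2 0 1) specK specU); rewrite ?rU ?r01; try lia.
    by move=> u uL; split=> //; rewrite mulmx0.
  apply: (bc_spectrum_le (L := col2 0 1) specU specK); rewrite ?rU ?r01; try lia.
  by move=> u uL; split=> //; rewrite mulmx0.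
have [k0|k0] := eqVneq k11 0.
  have a0 : a = 0 by rewrite /a k0 rmorph0.
  have [sT [specT eigT zT]] := bc_spectrum_exists q fN0 wpos
    (bc_form_T0 f e det1 a0) bK.
  rewrite rU in zT.
  exists sK, sT, sU; split; first by split; rewrite ?MT.
  split; first by rewrite /= zK zT zU subn0.
  split; split=> //.
  - by rewrite k0 mulr0 mul0r ltxx.
  - by rewrite k0 mulr0 mul0r ltxx.
  - by move=> cz; rewrite cz eqxx in c0.
  - move=> _ m mN; apply/andP; split.
      apply: (bc_spectrum_le (L := col2 0 1) specK specT); rewrite ?rU ?r01; try lia.
      by move=> u uL; split=> //; rewrite mulmx0.
    apply: (bc_spectrum_le (L := col2 0 1) specT specK); rewrite ?rU ?r01; try lia.
    by move=> u uL; split=> //; rewrite mulmx0.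
  - by move=> cz; rewrite cz eqxx in c0.
have a0 : a != 0 by rewrite rC_eq0.
have [sT [specT eigT zT]] := bc_spectrum_exists q fN0 wpos
  (bc_form_T1 c' F0 a0) bT.
rewrite r01 in zT.
have diffE u := beta_K_sub_T det1 ee (rC_real k11) u a0 D0.
(* The rank one difference of the forms vanishes on the kernel of [L], a constraint that costs at
   most one index. *)
pose L := col2 a (- e^*); have rL : (\rank L <= 1)%N by exact: rank_col2_le.
have eqL (u : 'rV_2) : u *m L = 0 -> (u *m beta_K f a b c' d e *m u^t*) 0 0 =
    (u *m beta_T a c' *m u^t*) 0 0.
  by rewrite diffE => ->; rewrite [X in `|X|]mxE normr0 expr0n mulr0 addr0.
have coefE : F / ((a - F * b) * a) = rC (f 0%N / (c * k11)).
  by rewrite DE -rmorphM -fmorphV -rmorphM.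
have sgE : (0 < f 0%N / (c * k11)) = (0 < c * k11 * f 0%N) /\
           (f 0%N / (c * k11) < 0) = (c * k11 * f 0%N < 0).
  have -> : f 0%N / (c * k11) = (c * k11 * f 0%N) / (c * k11) ^+ 2.
    by field; rewrite k0 c0.
  have p2 : 0 < ((c * k11) ^+ 2)^-1.
    by rewrite invr_gt0 lt0r sqr_ge0 expf_neq0 // mulf_neq0.
  by rewrite pmulr_lgt0 // pmulr_llt0.
exists sK, sT, sU; split; first by split; rewrite ?MT.
split; first by rewrite /= zK zT zU subn0.
split; split=> //.
(* Comparing the forms on all end values gives the bound at equal indices; their equality on the
   kernel of [L] gives the bound shifted by one. *)
- move=> pos; split=> m mN.
    apply: (bc_spectrum_le (L := 0 : 'M_(2, 1)) specT specK); rewrite ?r01; try lia.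
    move=> u _; rewrite !mulmx0; split=> //.
    rewrite diffE lerDl mulr_ge0 ?exprn_ge0 // coefE ler0c ltW //.
    by rewrite sgE.1.
  apply: (bc_spectrum_le (L := L) specK specT); rewrite ?r01; try lia.
  by move=> u uL; rewrite !mulmx0 eqL.
- move=> neg; split=> m mN.
    apply: (bc_spectrum_le (L := 0 : 'M_(2, 1)) specK specT); rewrite ?r01; try lia.
    move=> u _; rewrite !mulmx0; split=> //.
    rewrite diffE gerDl mulr_le0_ge0 ?exprn_ge0 // coefE lecR ltW //.
    by rewrite sgE.2.
  apply: (bc_spectrum_le (L := L) specT specK); rewrite ?r01; try lia.
  by move=> u uL; rewrite !mulmx0 eqL.
- by move=> cz; rewrite cz eqxx in c0.
- by move=> kz; rewrite kz eqxx in k0.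
- by move=> cz; rewrite cz eqxx in c0.
Qed.
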